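(* Let $\mathcal A=(a_1,\dots,a_n)$ be a full-dimensional point configuration in $\mathbb R^d$. Then each of the following determines each of the others: the set of sweep permutations $\Pi(\mathcal A)$, the poset of sweeps $\Sigma(\mathcal A)$, the sweep oriented matroid $\mathcal M(\mathcal A)$, and the big oriented matroid $\mathcal B(\mathcal A)$. Each of them determines the little oriented matroid $\mathcal L(\mathcal A)$, which does not always determine them (there exist configurations with the same little oriented matroid but different sets of sweep permutations).
   Context: For $u\in\mathbb R^d$, the sweep of $\mathcal A$ associated to $u$ is the ordered partition $(I_1,\dots,I_l)$ of $[n]$ such that $\langle u,a_i\rangle=\langle u,a_j\rangle$ for $i,j$ in the same block and $\langle u,a_i\rangle<\langle u,a_j\rangle$ if $i\in I_r$, $j\in I_s$, $r<s$. The poset of sweeps $\Sigma(\mathcal A)$ is the set of all sweeps ordered by refinement ($J$ refines $I$ if every block of $I$ is a union of consecutive blocks of $J$); its maximal elements are the sweep permutations $\Pi(\mathcal A)$. The oriented matroid of a vector configuration $(v_e)_{e\in E}$ in $\mathbb R^m$ has covectors $(\mathrm{sign}\langle u,v_e\rangle)_{e\in E}$ for $u\in\mathbb R^m$. With $\binom{[n]}{2}$ the set of pairs $(i,j)$, $i<j$: the little oriented matroid $\mathcal L(\mathcal A)$ is the oriented matroid on $[n]$ of the vectors $(a_i,1)\in\mathbb R^{d+1}$; the sweep oriented matroid $\mathcal M(\mathcal A)$ is the oriented matroid on $\binom{[n]}{2}$ of the vectors $a_j-a_i$; the big oriented matroid $\mathcal B(\mathcal A)$ is the oriented matroid on $[n]\cup\binom{[n]}{2}$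 of the vectors $(a_i,1)$, $i\in[n]$, and $(a_j-a_i,0)$, $(i,j)\in\binom{[n]}{2}$. *)

(* Defs.v *)
From mathcomp Require Import classical_sets reals.
From mathcomp Require Export all_boot all_order all_algebra.

Set Implicit Arguments.
Unset Strict Implicit.
Unset Printing Implicit Defensive.

Import Order.TTheory GRing.Theory Num.Theory.
Local Open Scope ring_scope.

Definition dotp (R : realType) (m : nat) (u v : 'rV[R]_m) : R :=
  \sum_(k < m) u 0 k * v 0 k.

(* The points need not be distinct. *)
Definition point_config (R : realType) (d n : nat) : Type := 'I_n -> 'rV[R]_d.

(* The affine hull of the points is the whole space; this forces 0 < n. *)
Definition full_dimensional (R : realType) (d n : nat)
    (A : point_config R d n) : Prop :=
  forall x : 'rV[R]_d, exists w : 'I_n -> R,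
    \sum_(i < n) w i = 1 /\ \sum_(i < n) w i *: A i = x.

(* [finset.partition] already excludes empty blocks. *)
Definition ordered_partition (n : nat) (I : seq {set 'I_n}) : bool :=
  uniq I && finset.partition [set B in I]%SET [set: 'I_n]%SET.

(* Out-of-range indices r give the empty block, hence impose nothing. *)
Definition is_sweep (R : realType) (d n : nat) (A : point_config R d n)
    (u : 'rV[R]_d) (I : seq {set 'I_n}) : Prop :=
  let block r := nth finset.set0 I r in
  [/\ ordered_partition I,
      forall (r : nat) (i j : 'I_n), i \in block r -> j \in block r ->
        dotp u (A i) = dotp u (A j)
    & forall (r s : nat) (i j : 'I_n), (r < s)%N ->
        i \in block r -> j \in block s -> dotp u (A i) < dotp u (A j)].

(* J refines I: the blocks of I, in order, are the unions of the successive
   groups of consecutive blocks of J.  Asking only that each block of I be such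
   a union, regardless of the order in which these groups occur in J, would
   make an ordered partition and its reverse refine each other. *)
Definition refines (n : nat) (J I : seq {set 'I_n}) : Prop :=
  exists2 K : seq (seq {set 'I_n}),
    J = flatten K & I = [seq (\bigcup_(B <- k) B)%SET | k <- K].

Definition sweeps (R : realType) (d n : nat) (A : point_config R d n) :
    set (seq {set 'I_n}) :=
  [set I | exists u : 'rV[R]_d, is_sweep A u I]%classic.

(* A labelled poset: the underlying set and its order relation. *)
Definition labelled_poset (T : Type) : Type := (set T * (T -> T -> Prop))%type.

Definition maximal_elements (T : Type) (P : labelled_poset T) : set T :=
  [set x | P.1 x /\ forall y, P.1 y -> P.2 x y -> y = x]%classic.

(* Finer sweeps are larger. *)
Definition sweep_poset (R : realType) (d n : nat) (A : point_config R d n) :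
    labelled_poset (seq {set 'I_n}) :=
  (sweeps A, fun I J => [/\ sweeps A I, sweeps A J & refines J I]).

(* If all points are distinct, the blocks of a maximal sweep are singletons,
   i.e. the sweep is a permutation of 'I_n written as a list of singletons. *)
Definition sweep_perms (R : realType) (d n : nat) (A : point_config R d n) :
    set (seq {set 'I_n}) :=
  maximal_elements (sweep_poset A).

(* An oriented matroid on the ground set E, given by its set of covectors;
   signs are the integers -1, 0, 1. *)
Definition oriented_matroid (R : realType) (E : finType) (m : nat)
    (v : E -> 'rV[R]_m) : set {ffun E -> int} :=
  [set X | exists u : 'rV[R]_m, X = [ffun e => sgz (dotp u (v e))]]%classic.

Definition ord_pair (n : nat) : finType := {p : 'I_n * 'I_n | (p.1 < p.2)%N}.

Definition lift_point (R : realType) (d n : nat) (A : point_config R d n)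
    (i : 'I_n) : 'rV[R]_(d + 1) :=
  row_mx (A i) 1%:M.

Definition pair_diff (R : realType) (d n : nat) (A : point_config R d n)
    (p : ord_pair n) : 'rV[R]_d :=
  A (val p).2 - A (val p).1.

Definition little_om (R : realType) (d n : nat) (A : point_config R d n) :
    set {ffun 'I_n -> int} :=
  oriented_matroid (lift_point A).

Definition sweep_om (R : realType) (d n : nat) (A : point_config R d n) :
    set {ffun ord_pair n -> int} :=
  oriented_matroid (pair_diff A).

Definition big_om (R : realType) (d n : nat) (A : point_config R d n) :
    set {ffun ('I_n + ord_pair n)%type -> int} :=
  oriented_matroid (fun e : 'I_n + ord_pair n =>
    match e with
    | inl i => lift_point A i
    | inr p => row_mx (pair_diff A p) 0
    end).

(* Main.v *)
(** A sweep is the ordered partition of [n] into level sets of a height function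
    [i |-> dotp u (A i)], so the sweeps, the covectors of the sweep oriented
    matroid and the weak orders induced by height functions are the same data.  A
    covector of the big oriented matroid is such an order with a threshold, and
    thresholds depend only on the order.  The maximal sweeps are those of generic
    [u], i.e. the topes; if every composition of an order of [A] with a tope of
    [A'] is an order of [A'], then so is that order itself, which recovers all
    sweeps from the maximal ones.  A square and a trapezoid have the same little
    oriented matroid, but only the square has two pairs of parallel sides. *)

Require Import Defs.
From mathcomp Require Import boolp.
From mathcomp Require Import reals all_boot all_algebra.
From mathcomp Require Import ring lra.

Set Implicit Arguments.
Unset Strict Implicit.
Unset Printing Implicit Defensive.

Import Order.TTheory GRing.Theory Num.Theory.
Local Open Scope ring_scope.

(** * Preliminaries on lists and comparisons *)

Lemma pairwise_flatten (T : Type) (r : rel T) (s : seq (seq T)) :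
  pairwise r (flatten s) = pairwise (allrel r) s && all (pairwise r) s.
Proof.
elim: s => //= x s IHs; rewrite pairwise_cat IHs.
have -> : allrel r x (flatten s) = all (allrel r x) s.
  by elim: s {IHs} => [|y s IHs] /=; rewrite ?allrel0r // allrel_catr IHs.
by rewrite -!andbA; do !bool_congr; rewrite andbCA.
Qed.

Lemma eq_of_lt (T : Type) (R S : realType) (f : T -> R) (g : T -> S) :
  (forall i j, (f i < f j) = (g i < g j)) -> forall i j, (f i == f j) = (g i == g j).
Proof. by move=> fg i j; rewrite !eq_le !leNgt !fg. Qed.

(** * The sweep of a real function on ['I_n]: uniqueness, equality and refinement *)

Section SweepOfFunction.
Context (R : realType) (n : nat).
Implicit Types (f g : 'I_n -> R) (I : seq {set 'I_n}).

Definition level f (v : R) : {set 'I_n} := [set i | f i == v]%SET.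

Definition values f : seq R := sort <=%R (undup (codom f)).

Definition sweep_of f : seq {set 'I_n} := map (level f) (values f).

(* [is_sweep A u] is [is_sweep_of] of the function [i |-> dotp u (A i)]. *)
Definition is_sweep_of f I : Prop :=
  let block r := nth finset.set0 I r in
  [/\ ordered_partition I,
      forall (r : nat) (i j : 'I_n), i \in block r -> j \in block r -> f i = f j
    & forall (r s : nat) (i j : 'I_n), (r < s)%N ->
        i \in block r -> j \in block s -> f i < f j].

Lemma mem_values f v : (v \in values f) = (v \in codom f).
Proof. by rewrite mem_sort mem_undup. Qed.

Lemma lt_sorted_values f : sorted <%R (values f).
Proof. by rewrite sort_lt_sorted undup_uniq. Qed.

Lemma valuesP f v : reflect (exists i, v = f i) (v \in values f).
Proof.
rewrite mem_values.
apply: (iffP codomP) => -[i ->]; by exists i.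
Qed.

Lemma mem_nth_sweep_of f r i :
  (i \in nth finset.set0 (sweep_of f) r) = (r == index (f i) (values f)).
Proof.
have fi : f i \in values f by apply/valuesP; exists i.
have [rs|sr] := ltnP r (size (values f)); last first.
  rewrite nth_default ?size_map // inE; apply/esym/negbTE.
  by apply: contraTneq sr => ->; rewrite -ltnNge index_mem.
rewrite (nth_map 0) // inE; apply/eqP/eqP => [->|->]; last by rewrite nth_index.
by rewrite index_uniq // sort_uniq undup_uniq.
Qed.

Lemma ltn_index_values f i j :
  (index (f i) (values f) < index (f j) (values f))%N = (f i < f j).
Proof.
have mi k : f k \in values f by apply/valuesP; exists k.
rewrite -(lt_sorted_ltn_nth 0 (lt_sorted_values f)) ?inE ?index_mem //.
by rewrite !nth_index.
Qed.

Lemma ordered_partition_cover I i :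
  ordered_partition I -> exists2 r, (r < size I)%N & i \in nth finset.set0 I r.
Proof.
case/andP=> _ /and3P[/eqP cI _ _].
have : i \in finset.cover [set B in I]%SET by rewrite cI inE.
case/finset.bigcupP=> B; rewrite inE => BI iB.
by exists (index B I); rewrite ?index_mem ?nth_index.
Qed.

Lemma ordered_partition_block I r :
  ordered_partition I -> (r < size I)%N -> exists i, i \in nth finset.set0 I r.
Proof.
case/andP=> _ /and3P[_ _ I0] rI; apply/finset.set0Pn.
by apply: contraNneq I0 => <-; rewrite inE mem_nth.
Qed.

Lemma ordered_partition_sweep_of f : ordered_partition (sweep_of f).
Proof.
apply/andP; split.
  rewrite map_inj_in_uniq ?sort_uniq ?undup_uniq //.
  move=> v w /valuesP[i ->] _ /setP/(_ i).
  by rewrite !inE eqxx => /esym/eqP.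
have -> : [set B in sweep_of f]%SET = preim_partition f [set: 'I_n]%SET.
  apply/setP=> B; rewrite inE; apply/mapP/imsetP => [[v /valuesP[i ->] ->]|[i _ ->]].
    by exists i; rewrite ?inE //; apply/setP=> j; rewrite !inE eq_sym.
  exists (f i); first by apply/valuesP; exists i.
  by apply/setP=> j; rewrite !inE eq_sym.
exact: preim_partitionP.
Qed.

Lemma is_sweep_of_sweep_of f : is_sweep_of f (sweep_of f).
Proof.
have fV i : f i \in values f by apply/valuesP; exists i.
split; first exact: ordered_partition_sweep_of.
  move=> r i j; rewrite !mem_nth_sweep_of => /eqP -> /eqP ij.
  by rewrite -(nth_index 0 (fV i)) ij nth_index.
move=> r s i j; rewrite !mem_nth_sweep_of => rs /eqP ir /eqP js.
by rewrite -ltn_index_values -ir -js.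
Qed.

(** Uniqueness: choosing one value of [f] per block gives a strictly increasing list of all values
    of [f], hence [values f], and each block is the level set of its value. *)
Lemma is_sweep_ofP f I : is_sweep_of f I <-> I = sweep_of f.
Proof.
split=> [[oI fconst fincr]|->]; last exact: is_sweep_of_sweep_of.
(* The default 0 is never taken on a block of [I], since these are nonempty. *)
pose rep (B : {set 'I_n}) := if [pick i in B] is Some i then f i else 0.
have repE r i : i \in nth finset.set0 I r -> rep (nth finset.set0 I r) = f i.
  rewrite /rep; case: pickP => [j jr ir|/(_ i) /= -> //].
  exact: fconst jr ir.
have levelE r : (r < size I)%N ->
    level f (rep (nth finset.set0 I r)) = nth finset.set0 I r.
  move=> /(ordered_partition_block oI) [i ir]; apply/setP=> j; rewrite inE (repE _ i) //.
  apply/eqP/idP => [fji|jr]; last exact: fconst jr ir.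
  have [s sI js] := ordered_partition_cover j oI.
  have [rs|sr|-> //] := ltngtP r s.
    by have := fincr _ _ _ _ rs ir js; rewrite fji ltxx.
  by have := fincr _ _ _ _ sr js ir; rewrite fji ltxx.
rewrite /sweep_of; have -> : values f = map rep I.
  apply: lt_sorted_eq; first exact: lt_sorted_values.
    rewrite lt_sorted_pairwise pairwise_map.
    apply/(pairwiseP finset.set0) => r s; rewrite !inE => rI sI rs /=.
    have [i ir] := ordered_partition_block oI rI.
    have [j js] := ordered_partition_block oI sI.
    by rewrite (repE _ i) // (repE _ j) //; exact: fincr ir js.
  move=> v; apply/valuesP/(nthP 0) => [[i ->]|[r]].
    have [r rI ir] := ordered_partition_cover i oI.
    by exists r; rewrite ?size_map // (nth_map finset.set0) // (repE _ i).
  rewrite size_map => rI <-; have [i ir] := ordered_partition_block oI rI.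
  by exists i; rewrite (nth_map finset.set0) // (repE _ i).
rewrite -map_comp -[LHS]map_id; apply/eq_in_map => B /(nthP finset.set0)[r rI <-].
by rewrite /= levelE.
Qed.

(** The position of the block containing an index can be read off the sweep, and it grows strictly
    with the value of the function. *)
Lemma sweep_of_eqP f g :
  sweep_of f = sweep_of g <-> forall i j, (f i < f j) = (g i < g j).
Proof.
split=> [fg i j|fg].
  have indexE k : index (f k) (values f) = index (g k) (values g).
    have := mem_nth_sweep_of f (index (f k) (values f)) k.
    by rewrite eqxx fg mem_nth_sweep_of => /eqP.
  by rewrite -!ltn_index_values !indexE.
apply/is_sweep_ofP; have [oI fconst fincr] := is_sweep_of_sweep_of f.
split=> // [r i j ir jr|r s i j rs ir js].
  by apply/eqP; rewrite -(eq_of_lt fg); apply/eqP; exact: fconst ir jr.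
by rewrite -fg; exact: fincr ir js.
Qed.

(** Being pairwise [before] survives merging consecutive blocks. Conversely, the condition makes [f]
    constant on the levels of [g], so the values of [g] can be grouped by level of [f] without
    reordering them. *)
Lemma refines_sweep_of f g :
  refines (sweep_of g) (sweep_of f) <-> forall i j, f i < f j -> g i < g j.
Proof.
(* [before] compares by [g] for the blocks of either sweep. *)
pose before (B C : {set 'I_n}) := [forall i in B, forall j in C, g i < g j].
have sweepP h : pairwise before (sweep_of h) <-> forall i j, h i < h j -> g i < g j.
  rewrite pairwise_map; split=> [/(pairwiseP 0) hP i j|hg].
    rewrite -ltn_index_values => ij.
    have hV k : h k \in values h by apply/valuesP; exists k.
    have := hP _ _ _ _ ij; rewrite !inE !index_mem !nth_index // => /(_ (hV i) (hV j)).
    move=> /forall_inP/(_ i); rewrite inE eqxx => /(_ isT).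
    by move=> /forall_inP/(_ j); rewrite inE eqxx => /(_ isT).
  have := lt_sorted_values h; rewrite lt_sorted_pairwise; apply: sub_pairwise.
  move=> v w vw; apply/forall_inP=> i; rewrite inE => /eqP iv.
  apply/forall_inP=> j; rewrite inE => /eqP jw.
  by apply: hg; rewrite iv jw.
split=> [[K gK fK]|fg].
  apply/sweepP; rewrite fK pairwise_map.
  have : pairwise before (sweep_of g) by apply/sweepP.
  rewrite gK pairwise_flatten => /andP[+ _]; apply: sub_pairwise => k l /allrelP kl.
  rewrite /= !bigcup_seq; apply/forall_inP=> i /bigcupP[B Bk iB].
  apply/forall_inP=> j /bigcupP[C Cl jC].
  by have /forall_inP/(_ _ iB)/forall_inP/(_ _ jC) := kl B C Bk Cl.
pose K := [seq [seq w <- values g | level g w \subset level f v] | v <- values f].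
have gf i j : g i = g j -> f i = f j.
  by move=> gij; case: (ltgtP (f i) (f j)) => // /fg; rewrite gij ltxx.
have level_sub i : level g (g i) \subset level f (f i).
  by apply/subsetP => j; rewrite !inE => /eqP/gf ->.
have fK : flatten K = values g.
  apply: lt_sorted_eq; last 1 first.
  - move=> w; apply/flattenP/idP => [[_ /mapP[v _ ->]]|/valuesP[i ->]].
      by rewrite mem_filter => /andP[].
    exists [seq w <- values g | level g w \subset level f (f i)].
      by apply: map_f; apply/valuesP; exists i.
    by rewrite mem_filter level_sub; apply/valuesP; exists i.
  - rewrite lt_sorted_pairwise pairwise_flatten all_map pairwise_map.
    apply/andP; split; last first.
      apply/allP=> v _ /=; rewrite -lt_sorted_pairwise.
      by apply: lt_sorted_filter; exact: lt_sorted_values.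
    have := lt_sorted_values f; rewrite lt_sorted_pairwise; apply: sub_pairwise.
    move=> v v' vv'; apply/allrelP => w w'; rewrite !mem_filter.
    move=> /andP[/subsetP wv /valuesP[i wE]] /andP[/subsetP wv' /valuesP[j wE']].
    rewrite wE wE'; apply: fg.
    have := wv i; rewrite !inE wE eqxx => /(_ isT)/eqP ->.
    by have := wv' j; rewrite !inE wE' eqxx => /(_ isT)/eqP ->.
  - exact: lt_sorted_values.
exists (map (map (level g)) K); first by rewrite -map_flatten fK.
rewrite -!map_comp; apply/eq_in_map => v /valuesP[i ->] /=.
rewrite bigcup_seq; apply/setP=> j; rewrite inE; apply/eqP/bigcupP => [ji|[B]].
  exists (level g (g j)); last by rewrite inE.
  apply: map_f; rewrite mem_filter -ji level_sub.
  by apply/valuesP; exists j.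
case/mapP=> w; rewrite mem_filter => /andP[/subsetP wv _] -> /wv.
by rewrite inE => /eqP.
Qed.

End SweepOfFunction.

(** * Inner products and small perturbations *)

Lemma dotpDl (R : realType) m (u v w : 'rV[R]_m) : dotp (u + v) w = dotp u w + dotp v w.
Proof. by rewrite -big_split; apply: eq_bigr => k _; rewrite mxE mulrDl. Qed.

Lemma dotpZl (R : realType) m a (u v : 'rV[R]_m) : dotp (a *: u) v = a * dotp u v.
Proof. by rewrite mulr_sumr; apply: eq_bigr => k _; rewrite mxE mulrA. Qed.

Lemma dotpBr (R : realType) m (u v w : 'rV[R]_m) : dotp u (v - w) = dotp u v - dotp u w.
Proof. by rewrite -sumrB; apply: eq_bigr => k _; rewrite !mxE mulrBr. Qed.

Lemma dotp0l (R : realType) m (v : 'rV[R]_m) : dotp 0 v = 0.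
Proof. by rewrite /dotp big1 // => k _; rewrite mxE mul0r. Qed.

Lemma dotp_row_mx (R : realType) m p (u : 'rV[R]_(m + p)) v w :
  dotp u (row_mx v w) = dotp (lsubmx u) v + dotp (rsubmx u) w.
Proof.
rewrite /dotp big_split_ord; congr (_ + _); apply: eq_bigr => k _.
  by rewrite row_mxEl mxE.
by rewrite row_mxEr mxE.
Qed.

Lemma dotp1 (R : realType) (u v : 'rV[R]_1) : dotp u v = u 0 0 * v 0 0.
Proof. exact: big_ord1. Qed.

Lemma small_perturbation (R : realType) (T : finType) (a b : T -> R) :
  exists2 e, 0 < e & forall t, 0 < a t -> 0 < a t + e * b t.
Proof.
have b1 t : 0 < 1 + `|b t| by rewrite ltr_pwDl.
(* The 1 in the denominator keeps the absolute value of [e * b t] strictly below [a t]; the initial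
   1 of the minimum serves when no [a t] is positive. *)
exists (\big[Order.min/1]_(t | 0 < a t) (a t / (1 + `|b t|))).
  by apply: lt_bigmin => // t at0; rewrite divr_gt0.
set e := \big[_/_]_(t | _) _ => t at0.
have e0 : 0 < e by apply: lt_bigmin => // s as0; rewrite divr_gt0.
have : e <= a t / (1 + `|b t|) by apply: bigmin_le_cond.
rewrite ler_pdivlMr // mulrDr mulr1 => eab.
have := ler_norm (- (e * b t)); rewrite normrN normrM (gtr0_norm e0); lra.
Qed.

(** * Height functions, composition of their orders, and generic directions *)

Section Heights.
Context (R : realType) (d n : nat) (A : point_config R d n).
Implicit Types (f g : 'I_n -> R) (u v w : 'rV[R]_d).

Definition height u : 'I_n -> R := fun i => dotp u (A i).

(** Composition of covectors, in terms of weak orders: [g] breaks the ties of [f]. *)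
Definition lexlt f g : rel 'I_n := fun i j => (f i < f j) || (f i == f j) && (g i < g j).

Definition tied f : {set 'I_n * 'I_n} := [set p | f p.1 == f p.2]%SET.

(** The topes. Since points may coincide, ties common to all directions are allowed. *)
Definition generic u : Prop :=
  forall i j v, height u i = height u j -> height v i = height v j.

Lemma heightE u a v i : height (u + a *: v) i = height u i + a * height v i.
Proof. by rewrite /height dotpDl dotpZl. Qed.

(** A small step along [v] keeps the strict inequalities of [u] and lets [v] decide its ties, so
    orders of [A] are closed under composition. *)
Lemma height_lexlt u v : exists2 e, 0 < e &
  forall i j, (height (u + e *: v) i < height (u + e *: v) j) =
              lexlt (height u) (height v) i j.
Proof.
have [e e0 eP] := small_perturbation
  (fun p : 'I_n * 'I_n => height u p.2 - height u p.1)
  (fun p => height v p.2 - height v p.1).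
exists e => // i j; rewrite /lexlt !heightE.
have [uij|uji|->] := ltgtP (height u i) (height u j) => /=.
- by have := eP (i, j); rewrite /= subr_gt0 => /(_ uij) ?; lra.
- by have := eP (j, i); rewrite /= subr_gt0 => /(_ uji) ?; lra.
- by rewrite ltrD2l ltr_pM2l.
Qed.

Lemma eq_of_lexlt u f g :
  (forall i j, (height u i < height u j) = lexlt f g i j) ->
  forall i j, (height u i == height u j) = (f i == f j) && (g i == g j).
Proof.
move=> ufg i j; rewrite eq_le !leNgt !ufg /lexlt.
by case: (ltgtP (f i) (f j)) => //= _; case: (ltgtP (g i) (g j)).
Qed.

Lemma generic_lexlt u v w : generic v ->
  (forall i j, (height w i < height w j) = lexlt (height u) (height v) i j) ->
  generic w.
Proof.
move=> gv wuv i j x /eqP; rewrite (eq_of_lexlt wuv) => /andP[_ /eqP].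
exact: gv.
Qed.

Lemma not_tiedP (Z : {set 'I_n * 'I_n}) :
  (exists p v, p \in Z /\ height v p.1 != height v p.2) \/
  (forall p v, p \in Z -> height v p.1 = height v p.2).
Proof.
have [|H] := EM (exists p v, p \in Z /\ height v p.1 != height v p.2); first by left.
right=> p v pZ; apply/eqP; apply: contra_notT H => pv.
by exists p, v.
Qed.

(** A perturbation separating a tied pair creates no new tie, so the number of ties drops until only
    those common to all directions remain. *)
Lemma exists_generic : exists u, generic u.
Proof.
have [m] := ubnP #|tied (height 0)|; move: (0 : 'rV_d) => u.
elim: m u => // m IHm u um.
have [[p [v [pu pv]]]|allt] := not_tiedP (tied (height u)); last first.
  by exists u => i j v uij; apply: (allt (i, j)); rewrite inE uij.
have [e _ /eq_of_lexlt eP] := height_lexlt u v.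
apply: (IHm (u + e *: v)); rewrite ltnS in um; apply: leq_trans um; apply: proper_card.
apply/properP; split; last first.
  by exists p => //; rewrite inE eP (negPf pv) andbF.
by apply/subsetP=> q; rewrite !inE eP => /andP[].
Qed.

(* The oriented-matroid fact that a sign vector whose compositions with all
   topes are topes is a covector: if composing with [v] and [-v] gives [w+] and
   [w-], a positive combination of [w+] and [w-] kills one more tie. *)
Lemma realize_of_generic f :
  (forall v, generic v -> exists w, forall i j,
     (height w i < height w j) = lexlt f (height v) i j) ->
  exists w, forall i j, (height w i < height w j) = (f i < f j).
Proof.
move=> fgen.
(* Composing [f] with an arbitrary [v] permits induction on the number of common ties; [v = 0]
   breaks none and gives back [f]. *)
suff main v : exists w, forall i j, (height w i < height w j) = lexlt f (height v) i j.
  have [w wP] := main 0; exists w => i j.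
  by rewrite wP /lexlt /height !dotp0l ltxx andbF orbF.
pose Z v := tied f :&: tied (height v).
have [m] := ubnP #|Z v|; elim: m v => // m IHm v vm.
(* Breaking ties further by [x] leaves fewer common ties, so the outer induction realizes [f]
   composed with [v] and then [x]. *)
have step p x : p \in Z v -> height x p.1 != height x p.2 ->
    exists w, forall i j, (height w i < height w j) =
      (lexlt f (height v) i j) || ((i, j) \in Z v) && (height x i < height x j).
  move=> pZ px; have [e _ eP] := height_lexlt v x.
  have [|w wP] := IHm (v + e *: x).
    rewrite ltnS in vm; apply: leq_trans vm; apply: proper_card; apply/properP; split.
      apply: setIS; apply/subsetP=> q; rewrite !inE (eq_of_lexlt eP).
      by case/andP.
    by exists p => //; rewrite !inE (eq_of_lexlt eP) (negPf px) !andbF.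
  exists w => i j; rewrite wP {1}/lexlt eP /lexlt !inE /=.
  by case: ltgtP => //= _; case: ltgtP.
have [[p [x [pZ px]]]|allt] := not_tiedP (Z v); last first.
  (* The ties left in [Z v] are shared by all directions, so perturbing [v] by a generic [g] makes
     it generic without changing the composed order. *)
  have [g gg] := exists_generic; have [e _ eP] := height_lexlt v g.
  have [w wP] := fgen _ (generic_lexlt gg eP); exists w => i j.
  rewrite wP {1}/lexlt eP /lexlt.
  have := allt (i, j) g; rewrite !inE /=.
  case: ltgtP => //= _; case: ltgtP => //= _ /(_ isT) ->.
  by rewrite ltxx.
(* Inner induction on the number of pairs of [Z v] that [x] separates. *)
have [k] := ubnP #|Z v :\: tied (height x)|.
elim: k p x pZ px => // k IHk p x pZ px xk.
have Zsym q : q \in Z v -> (q.2, q.1) \in Z v.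
  by rewrite !inE /= ![_ q.2 == _]eq_sym.
wlog px_lt : p pZ px / height x p.1 < height x p.2.
  move=> wl; have [|lt_px|xx] := ltgtP (height x p.1) (height x p.2); first exact: wl.
    by apply: (wl (p.2, p.1)) => //=; [exact: Zsym | rewrite eq_sym].
  by rewrite xx eqxx in px.
have [wp wpP] := step p x pZ px.
have hN i : height (- x) i = - height x i.
  by rewrite -scaleN1r /height dotpZl mulN1r.
have [|wm wmP] := step p (- x) pZ; first by rewrite !hN eqr_opp.
have wpp : height wp p.1 < height wp p.2.
  by rewrite wpP -surjective_pairing pZ px_lt orbT.
have wmp : height wm p.2 < height wm p.1.
  by rewrite wmP Zsym // !hN ltrN2 px_lt orbT.
(* The weight at which the opposite differences of [wp] and [wm] on [p] cancel. *)
pose t := (height wm p.1 - height wm p.2) / (height wp p.2 - height wp p.1).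
have t0 : 0 < t by rewrite divr_gt0 // subr_gt0.
pose y := wm + t *: wp.
have ylt i j : lexlt f (height v) i j -> height y i < height y j.
  move=> ij; rewrite !heightE; apply: ltrD; first by rewrite wmP ij.
  by rewrite ltr_pM2l // wpP ij.
have yp : height y p.1 = height y p.2.
  rewrite !heightE /t; field.
  by rewrite subr_eq0 gt_eqF.
have Zlex i j : (i, j) \in Z v -> lexlt f (height v) i j = false.
  by rewrite !inE /lexlt /= => /andP[/eqP -> /eqP ->]; rewrite !ltxx andbF.
(* On [Z v] every tie of [x] is a tie of [wp] and [wm], so [y] separates only pairs that [x]
   separates, and no longer [p]. *)
have yx i j : (i, j) \in Z v -> height x i = height x j -> height y i = height y j.
  move=> ijZ xij; have jiZ := Zsym _ ijZ; rewrite /= in jiZ.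
  have tie w z : (forall i' j', (height w i' < height w j') =
      (lexlt f (height v) i' j') || ((i', j') \in Z v) && (height z i' < height z j')) ->
      height z i = height z j -> height w i = height w j.
    move=> wP zij; apply/eqP; rewrite eq_le !leNgt !wP !Zlex //= zij ltxx.
    by rewrite !andbF.
  by rewrite !heightE (tie _ _ wpP) // (tie _ _ wmP) // !hN xij.
(* If [y] still separates a pair of [Z v], it replaces [x] in the inner induction; otherwise [y]
   realizes the composed order. *)
have [Zy|[q]] := set_0Vmem (Z v :\: tied (height y)); last first.
  rewrite finset.in_setD => /andP[qy qZ].
  apply: (IHk q y qZ); first by move: qy; rewrite inE.
  rewrite ltnS in xk; apply: leq_trans xk; apply: proper_card; apply/properP; split.
    apply/subsetP=> -[i j]; rewrite !finset.in_setD => /andP[ijy ijZ].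
    rewrite ijZ andbT; apply: contra ijy; rewrite !inE /= => /eqP/(yx _ _ ijZ) ->.
    by rewrite eqxx.
  exists p; first by rewrite finset.in_setD pZ inE px.
  by rewrite finset.in_setD inE yp eqxx.
exists y => i j; apply/idP/idP; last exact: ylt.
have [//|nij] := boolP (lexlt f (height v) i j).
have [ji|nji] := boolP (lexlt f (height v) j i).
  by move/lt_trans => /(_ _ (ylt _ _ ji)); rewrite ltxx.
have ijZ : (i, j) \in Z v.
  move: nij nji; rewrite !inE /lexlt /=.
  by case: ltgtP => //= _; case: ltgtP.
have : (i, j) \notin Z v :\: tied (height y) by rewrite Zy inE.
by rewrite finset.in_setD ijZ andbT negbK inE /= => /eqP ->; rewrite ltxx.
Qed.

End Heights.

(** * Sweeps and sweep permutations in terms of heights *)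

Lemma sweepsP (R : realType) d n (A : point_config R d n) I :
  sweeps A I <-> exists u, I = sweep_of (height A u).
Proof.
by split=> -[u uI]; exists u; apply/is_sweep_ofP.
Qed.

(** Perturbing by a generic direction refines any sweep, so a maximal one is already generic; a
    generic direction has only unavoidable ties, so nothing refines its sweep properly. *)
Lemma sweep_permsP (R : realType) d n (A : point_config R d n) I :
  sweep_perms A I <-> exists2 u, generic A u & I = sweep_of (height A u).
Proof.
split=> [[/sweepsP[u ->] umax]|[u gu ->]].
  have [g gg] := exists_generic A; have [e _ eP] := height_lexlt A u g.
  exists (u + e *: g); first exact: generic_lexlt gg eP.
  apply/esym/umax; first by apply/sweepsP; exists (u + e *: g).
  split; try by apply/sweepsP; eexists.
  by apply/refines_sweep_of => i j ij; rewrite eP /lexlt ij.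
split; first by apply/sweepsP; exists u.
move=> _ /sweepsP[v ->] [_ _ /refines_sweep_of uv].
apply/sweep_of_eqP => i j; apply/idP/idP; last exact: uv.
have [//|ji|/gu ->] := ltgtP (height A u i) (height A u j); last by rewrite ltxx.
by move/lt_trans => /(_ _ (uv _ _ ji)); rewrite ltxx.
Qed.

(** * Transfer of orders and covectors from one configuration to another *)

Section Transfer.
Context (R : realType) (n d d' : nat).
Variables (A : point_config R d n) (A' : point_config R d' n).

Definition realizes_orders : Prop := forall u, exists u', forall i j,
  (height A' u' i < height A' u' j) = (height A u i < height A u j).

(** A tope of [A'] is a tope of [A]; composing an order of [A] with it gives a tope of [A], hence
    one of [A'], which is what [realize_of_generic] requires. *)
Lemma realizes_orders_sweep_perms : sweep_perms A = sweep_perms A' -> realizes_orders.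
Proof.
move=> AA' u; apply: realize_of_generic => v gv.
have : sweep_perms A' (sweep_of (height A' v)) by apply/sweep_permsP; exists v.
rewrite -AA' => /sweep_permsP[w gw /sweep_of_eqP vw].
have [e _ eP] := height_lexlt A u w.
have : sweep_perms A (sweep_of (height A (u + e *: w))).
  by apply/sweep_permsP; exists (u + e *: w) => //; exact: generic_lexlt gw eP.
rewrite AA' => /sweep_permsP[y _ /sweep_of_eqP yP].
by exists y => i j; rewrite -yP eP /lexlt vw.
Qed.

Lemma realizes_orders_sweeps :
  (forall I, sweeps A I -> sweeps A' I) <-> realizes_orders.
Proof.
split=> [AA' u|AA' I].
  have /AA'/sweepsP[v /sweep_of_eqP uv] : sweeps A (sweep_of (height A u)).
    by apply/sweepsP; exists u.
  by exists v => i j; rewrite uv.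
case/sweepsP=> u ->; have [v vu] := AA' u.
by apply/sweepsP; exists v; apply/sweep_of_eqP => i j; rewrite vu.
Qed.

Lemma eq_sgz_pair_diff u u' :
  (forall p : ord_pair n, sgz (dotp u (pair_diff A p)) = sgz (dotp u' (pair_diff A' p))) <->
  (forall i j, (height A' u' i < height A' u' j) = (height A u i < height A u j)).
Proof.
split=> [uu' i j|uu' p].
  have [ij|ji|/val_inj ->] := ltngtP i j; last by rewrite !ltxx.
    have := uu' (Sub (i, j) ij); rewrite /pair_diff !dotpBr /= => s.
    by rewrite -subr_gt0 -sgz_gt0 -s sgz_gt0 subr_gt0.
  have := uu' (Sub (j, i) ji); rewrite /pair_diff !dotpBr /= => s.
  by rewrite -subr_lt0 -sgz_lt0 -s sgz_lt0 subr_lt0.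
rewrite /pair_diff !dotpBr -!/(height _ _ _).
have := uu' (val p).1 (val p).2; have := uu' (val p).2 (val p).1.
case: (ltgtP (height A u _)) => [ij|ij|->] h1 h2;
  case: (ltgtP (height A' u' _)) h1 h2 => // c _ _; last by rewrite c !subrr.
  by rewrite !ltr0_sgz ?subr_lt0.
by rewrite !gtr0_sgz ?subr_gt0.
Qed.

Lemma realizes_orders_sweep_om :
  (forall X, sweep_om A X -> sweep_om A' X) <-> realizes_orders.
Proof.
split=> [AA' u|AA' X [u ->]].
  have [|u' uu'] := AA' [ffun p => sgz (dotp u (pair_diff A p))]; first by exists u.
  exists u'; apply/eq_sgz_pair_diff => p.
  by have /ffunP/(_ p) := uu'; rewrite !ffunE.
have [u' /eq_sgz_pair_diff uu'] := AA' u.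
by exists u'; apply/ffunP => p; rewrite !ffunE.
Qed.

(** Restricting the big oriented matroid to pairs gives the sweep oriented matroid, because the last
    coordinate of the pair vectors is 0. *)
Lemma realizes_orders_big_om :
  (forall X, big_om A X -> big_om A' X) -> realizes_orders.
Proof.
move=> AA' u; pose v := row_mx u 0 : 'rV[R]_(d + 1).
have [|v' vv'] := AA' [ffun e => sgz (dotp v match e with
    | inl i => lift_point A i | inr p => row_mx (pair_diff A p) 0 end)].
  by exists v.
exists (lsubmx v'); apply/eq_sgz_pair_diff => p.
have /ffunP/(_ (inr p)) := vv'; rewrite !ffunE !dotp_row_mx row_mxKl.
by rewrite !dotp1 [(0 : 'rV_1) _ _]mxE !mulr0 !addr0.
Qed.

(** The signs of [f + c] cut the order of [f] at one place; [g] induces the same order and can be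
    cut there too. *)
Lemma threshold (f g : 'I_n -> R) c :
  (forall i j, (f i < f j) = (g i < g j)) ->
  exists c', forall i, sgz (f i + c) = sgz (g i + c').
Proof.
move=> fg.
suff [c' c'P] : exists c', forall i, (0 < f i + c -> 0 < g i + c') /\
    (f i + c < 0 -> g i + c' < 0) /\ (f i + c = 0 -> g i + c' = 0).
  exists c' => i; have [p [q r]] := c'P i.
  have [/[dup]/p ? ?|/[dup]/q ? ?|/esym/[dup]/r -> ->] := ltgtP 0 (f i + c) => //.
    by rewrite !gtr0_sgz.
  by rewrite !ltr0_sgz.
case: (pickP (fun i => f i + c == 0)) => [i0 /eqP fi0|fc].
  (* Some point lies on the cut: [g] is cut at its value there. *)
  exists (- g i0) => i; have := fg i i0; have := fg i0 i.
  by case: (ltgtP (g i)) => gi h1 h2; (split; last split) => ?; lra.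
have fc0 i : f i + c <> 0 by move/eqP; rewrite fc.
case: (pickP (fun i => f i + c < 0)) => [i1 fi1|fpos]; last first.
  (* All signs are positive: the shift exceeds every absolute value of [g]. *)
  exists (1 + \sum_i `|g i|) => i; (split; last split) => fi.
  - have : `|g i| <= \sum_j `|g j| by rewrite (bigD1 i) //= lerDl sumr_ge0.
    by have := ler_norm (- g i); rewrite normrN; lra.
  - by move: (fpos i); rewrite /= fi.
  - by have := fc0 i.
case: (@arg_maxP _ _ _ i1 (fun i => f i + c < 0) g fi1) => m fm mmax.
case: (pickP (fun i => 0 < f i + c)) => [i2 fi2|fneg]; last first.
  exists (- g m - 1) => i; (split; last split) => fi.
  - by move: (fneg i); rewrite /= fi.
  - by have := mmax i fi => /= ?; lra.
  - by have := fc0 i.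
case: (@arg_minP _ _ _ i2 (fun i => 0 < f i + c) g fi2) => M fM Mmin.
have : g m < g M by rewrite -fg; lra.
(* The cut goes midway between the highest negative and the lowest positive point. *)
move=> mM; exists (- (g m + g M) / 2) => i; (split; last split) => fi.
- by have := Mmin i fi => /= ?; lra.
- by have := mmax i fi => /= ?; lra.
- by have := fc0 i.
Qed.

(** A covector comes from an affine function: its linear part is transferred as an order, its
    constant term by [threshold]. *)
Lemma big_om_realizes_orders :
  realizes_orders -> forall X, big_om A X -> big_om A' X.
Proof.
move=> AA' _ [v ->]; have [u' uu'] := AA' (lsubmx v).
have [c' c'P] := threshold (rsubmx v 0 0) (fun i j => esym (uu' i j)).
exists (row_mx u' (const_mx c')); apply/ffunP => -[i|p]; rewrite !ffunE !dotp_row_mx.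
  rewrite row_mxKl row_mxKr !dotp1 [1%:M _ _]mxE [const_mx _ _ _]mxE !mulr1; exact: c'P.
rewrite row_mxKl !dotp1 [(0 : 'rV_1) _ _]mxE !mulr0 !addr0.
by move: p; apply/eq_sgz_pair_diff.
Qed.

Lemma little_om_big_om :
  (forall X, big_om A X -> big_om A' X) -> forall X, little_om A X -> little_om A' X.
Proof.
move=> AA' _ [v ->]; have [|v' vv'] := AA' [ffun e => sgz (dotp v match e with
    | inl i => lift_point A i | inr p => row_mx (pair_diff A p) 0 end)].
  by exists v.
by exists v'; apply/ffunP => i; have /ffunP/(_ (inl i)) := vv'; rewrite !ffunE.
Qed.

End Transfer.

(** * Equivalence of the four data *)

Lemma subset_eqP (T : Type) (P Q : T -> Prop) :
  P = Q <-> (forall x, P x -> Q x) /\ (forall x, Q x -> P x).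
Proof.
split=> [->//|[PQ QP]]; apply/predeqP => x; split; [exact: PQ | exact: QP].
Qed.

Lemma sweep_om_tfae (R : realType) n d d' (A : point_config R d n) (A' : point_config R d' n) :
  [<-> sweep_perms A = sweep_perms A'; sweep_poset A = sweep_poset A';
       sweep_om A = sweep_om A'; big_om A = big_om A'].
Proof.
have poset_sweeps : sweeps A = sweeps A' -> sweep_poset A = sweep_poset A'.
  by rewrite /sweep_poset => ->.
have sweeps_orders : sweeps A = sweeps A' <-> realizes_orders A A' /\ realizes_orders A' A.
  split=> [/subset_eqP[AA' A'A]|[AA' A'A]]; last apply/subset_eqP.
    by split; apply/realizes_orders_sweeps.
  by split; apply/realizes_orders_sweeps.
tfae=> [AA'|AA'|AA'|AA'].
- apply/poset_sweeps/sweeps_orders.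
  by split; apply: realizes_orders_sweep_perms.
- have [oAA' oA'A] : realizes_orders A A' /\ realizes_orders A' A.
    by apply/sweeps_orders; exact: (congr1 fst AA').
  by apply/subset_eqP; split; apply/realizes_orders_sweep_om.
- have /subset_eqP[/realizes_orders_sweep_om oAA' /realizes_orders_sweep_om oA'A] := AA'.
  by apply/subset_eqP; split; apply: big_om_realizes_orders.
- have /subset_eqP[/realizes_orders_big_om oAA' /realizes_orders_big_om oA'A] := AA'.
  by rewrite /sweep_perms poset_sweeps //; apply/sweeps_orders.
Qed.

(** * Two quadrilaterals with the same little oriented matroid *)

Section SquareAndTrapezoid.
Context (R : realType).

Definition planar (xs ys : seq R) : point_config R 2 4 :=
  fun i => \row_(k < 2) (if k == 0 then xs`_i else ys`_i).

Definition square := planar [:: 0; 1; 1; 0] [:: 0; 0; 1; 1].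
Definition trapezoid := planar [:: 0; 1; 2; 0] [:: 0; 0; 1; 1].

Lemma dotp_planar (u : 'rV[R]_2) xs ys i :
  dotp u (planar xs ys i) = u 0 0 * xs`_i + u 0 1 * ys`_i.
Proof.
have -> : 1 = lift ord0 ord0 :> 'I_2 by exact: val_inj.
by rewrite /dotp 2!big_ord_recl big_ord0 addr0 !mxE.
Qed.

Lemma full_dimensional_planar x y : full_dimensional (planar [:: 0; 1; x; 0] [:: 0; 0; y; 1]).
Proof.
(* Barycentric coordinates in the triangle of the origin and the two unit vectors; the point
   [(x, y)] gets weight 0. *)
move=> z; exists (fun i => [:: 1 - z 0 0 - z 0 1; z 0 0; 0; z 0 1]`_i).
rewrite 4!big_ord_recl big_ord0 /=; split; first by ring.
apply/rowP => k; rewrite !big_ord_recl big_ord0 !mxE /=.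
case: k => [[|[|//]] kP] /=; rewrite !(mulr0, mulr1, add0r, addr0, mul0r);
 congr (z _ _); exact: val_inj.
Qed.

Lemma little_om_planarP xs ys X : little_om (planar xs ys) X <->
  exists a b c, X = [ffun i : 'I_4 => sgz (a * xs`_i + b * ys`_i + c)].
Proof.
split=> [[v ->]|[a [b [c ->]]]].
  exists (lsubmx v 0 0), (lsubmx v 0 1), (rsubmx v 0 0); apply/ffunP => i.
  by rewrite !ffunE dotp_row_mx dotp_planar dotp1 [1%:M _ _]mxE mulr1.
exists (row_mx (\row_(k < 2) if k == 0 then a else b) (const_mx c)).
apply/ffunP => i; rewrite !ffunE dotp_row_mx row_mxKl row_mxKr dotp_planar dotp1.
by rewrite !mxE mulr1.
Qed.

(* The convex quadrilaterals satisfy [p0 - p1 + p2 - p3 = 0], respectively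
   [2 p0 - 2 p1 + p2 - p3 = 0], so doubling the values at [p2] and [p3] maps
   affine functions on the first one to affine functions on the second. *)
Lemma little_om_square_trapezoid : little_om square = little_om trapezoid.
Proof.
have sgz2 (x y : R) : y = 2 * x -> sgz x = sgz y.
  by move=> ->; rewrite sgzM (gtr0_sgz (ltr0n R 2)) mul1r.
apply/predeqP => X; split=> /little_om_planarP[a [b [c ->]]]; apply/little_om_planarP.
  exists a, (2 * b + c), c; apply/ffunP => -[[|[|[|[|//]]]] iP]; rewrite !ffunE /=.
  - by congr (sgz _); ring.
  - by congr (sgz _); ring.
  - by apply: sgz2; ring.
  - by apply: sgz2; ring.
exists a, ((b - c) / 2), c; apply/ffunP => -[[|[|[|[|//]]]] iP]; rewrite !ffunE /=.
- by congr (sgz _); ring.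
- by congr (sgz _); ring.
- by apply/esym/sgz2; field.
- by apply/esym/sgz2; field.
Qed.

(** In the square, [p 3 - p 0] and [p 2 - p 1] are equal; in the trapezoid the direction [(-2, 1)]
    is positive on the first and negative on the second. *)
Lemma sweep_om_square_trapezoid : sweep_om square <> sweep_om trapezoid.
Proof.
move/subset_eqP=> [_ /realizes_orders_sweep_om TS].
pose p k : 'I_4 := inord k.
have [v vP] := TS (\row_(k < 2) if k == 0 then - 2 else 1).
have := vP (p 0) (p 3); have := vP (p 1) (p 2).
rewrite /height !dotp_planar !mxE /p !inordK //= !(mulr0, mulr1, addr0, add0r).
have -> : (- 2 < - 2 * 2 + 1 :> R) = false by lra.
have -> : (0 < 1 :> R) by lra.
by rewrite ltrDl => ->.
Qed.

End SquareAndTrapezoid.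

Theorem theorem3p5 (R : realType) :
  (forall (n d d' : nat) (A : point_config R d n) (A' : point_config R d' n),
     full_dimensional A -> full_dimensional A' ->
     [<-> sweep_perms A = sweep_perms A';
          sweep_poset A = sweep_poset A';
          sweep_om A = sweep_om A';
          big_om A = big_om A']
     /\ [/\ sweep_perms A = sweep_perms A' -> little_om A = little_om A',
            sweep_poset A = sweep_poset A' -> little_om A = little_om A',
            sweep_om A = sweep_om A' -> little_om A = little_om A'
          & big_om A = big_om A' -> little_om A = little_om A'])
  /\
  (exists (n d : nat) (A A' : point_config R d n),
     full_dimensional A /\ full_dimensional A' /\
     little_om A = little_om A' /\
     [/\ sweep_perms A <> sweep_perms A',
         sweep_poset A <> sweep_poset A',
         sweep_om A <> sweep_om A'
       & big_om A <> big_om A']).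
Proof.
split=> [n d d' A A' _ _|].
  have tfaeA := sweep_om_tfae A A'; split=> //.
  (* The little oriented matroid is the restriction of the big one to ['I_n], so each datum is first
     carried to the big one. *)
  have little : big_om A = big_om A' -> little_om A = little_om A'.
    by case/subset_eqP=> AA' A'A; apply/subset_eqP; split; apply: little_om_big_om.
  split=> [/(tfaeA 0 3)|/(tfaeA 1 3)|/(tfaeA 2 3)|]; exact: little.
exists 4, 2, (square R), (trapezoid R).
split; first exact: full_dimensional_planar.
split; first exact: full_dimensional_planar.
split; first exact: little_om_square_trapezoid.
have tfaeA := sweep_om_tfae (square R) (trapezoid R).
have neq := @sweep_om_square_trapezoid R.
by split=> // [/(tfaeA 0 2)|/(tfaeA 1 2)|/(tfaeA 3 2)].
Qed.
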